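(* Let $u,v$ be indeterminates and, for $\nu\in\mathbb N=\{1,2,\dots\}$, put $\tau=\nu+1$ and $$c_{u,v,2}(\nu)=-\tau(\tau+1)^2(2\tau-1)\Big(-3(2\tau-1)^2u^2-(10\tau^2-10\tau+3)uv+2(3\tau^4-6\tau^3+4\tau^2-\tau)v^2\Big),$$ $$c_{u,v,1}(\nu)=-12(68\tau^6-45\tau^4+12\tau^2-1)u^2-8(157\tau^6-106\tau^4+30\tau^2-3)uv+4(102\tau^8-170\tau^6+89\tau^4-24\tau^2+3)v^2,$$ $$c_{u,v,0}(\nu)=\tau(\tau-1)^2(2\tau+1)\Big(3(4\tau^2+4\tau+1)u^2+(10\tau^2+10\tau+3)uv-2(3\tau^4+6\tau^3+4\tau^2+\tau)v^2\Big).$$ Define $b_{u,v}(0)=4(3u+2v)$, $b_{u,v}(1)=34u+52v$, $b_{u,v}(\nu+1)=-c_{u,v,1}(\nu)$ for $\nu\ge1$; $a_{u,v}(1)=(u+v)(327u+500v)-b_{u,v}(0)b_{u,v}(1)$, $a_{u,v}(2)=-(u+v)c_{u,v,0}(1)$, $a_{u,v}(\nu+1)=-c_{u,v,0}(\nu)c_{u,v,2}(\nu-1)$ for $\nu\ge2$. Let $P_{u,v}(\nu),Q_{u,v}(\nu)$ be the numerators and denominators of the convergents of the continued fraction $$b_{u,v}(0)+\frac{a_{u,v}(1)}{b_{u,v}(1)+\dfrac{a_{u,v}(2)}{b_{u,v}(2)+\dfrac{a_{u,v}(3)}{b_{u,v}(3)+\cdots}}},$$ i.e. $P_{u,v}(-1)=1$,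 $Q_{u,v}(-1)=0$, $P_{u,v}(0)=b_{u,v}(0)$, $Q_{u,v}(0)=1$ and $P_{u,v}(\nu)=b_{u,v}(\nu)P_{u,v}(\nu-1)+a_{u,v}(\nu)P_{u,v}(\nu-2)$, $Q_{u,v}(\nu)=b_{u,v}(\nu)Q_{u,v}(\nu-1)+a_{u,v}(\nu)Q_{u,v}(\nu-2)$ for $\nu\ge1$. For $\nu\in\mathbb N_0$ and $r\in\{1,2\}$ let $\beta^{*(r)}_2(1;\nu)=\sum_{k=0}^{\nu+1}k^r\left(\binom{\nu+1}{k}\binom{\nu+k}{k}\right)^2$, and let $$\mathfrak B=\left\{-\beta^{*(2)}_2(1;\nu)/\beta^{*(1)}_2(1;\nu)\ :\ \nu\in\mathbb N_0\right\}.$$ For $x>0$ let $\Delta(x)=18x^2(2x+1)+(7x+3)^2$ and $\rho_k(x)=\dfrac{5x+3+(-1)^k\sqrt{\Delta(x)}}{x(3x+2)}$, and let $$\mathfrak A=\{\rho_k(x)\ :\ x=2\nu(\nu+1),\ \nu\in\mathbb N,\ k=1,2\}.$$ Let $F,G$ be real numbers with $F+G\neq0$, $(F+G)G\ge0$, and, in case $F\ne0$, $G/F\notin\mathfrak B\cup\mathfrak A$. Then: (i) for every $\nu\in\mathbb N_0$, $Q_{F,G}(\nu)\neq 0$ (so every convergent $P_{F,G}(\nu)/Q_{F,G}(\nu)$ of the specialized continued fraction at $u=F$, $v=G$ is well defined), and $$\lim_{\nu\to\infty}\frac{P_{F,G}(\nu)}{Q_{F,G}(\nu)}=8(F+G)\zeta(3);$$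 (ii) $P_{u,v}(\nu)$ and $Q_{u,v}(\nu)$ are homogeneous polynomials in $\mathbb Z[u,v]$, and for all $\nu\in\mathbb N_0$ $$\max(2\nu,1)=\deg_u P_{u,v}(\nu)=\deg_v P_{u,v}(\nu)=\deg P_{u,v}(\nu),\qquad \max(2\nu-1,0)=\deg_u Q_{u,v}(\nu)=\deg_v Q_{u,v}(\nu)=\deg Q_{u,v}(\nu).$$
   Context: $\zeta(3)=\sum_{n\ge1}n^{-3}$. $\mathbb N_0=\{0,1,2,\dots\}$. $\deg_u$, $\deg_v$ denote degrees in the indicated variable and $\deg$ the total degree. *)

(* Defs.v *)
From mathcomp Require Import all_boot all_order all_algebra.
From mathcomp Require mpoly.

Set Implicit Arguments.
Unset Strict Implicit.
Unset Printing Implicit Defensive.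

Import Order.TTheory GRing.Theory Num.Theory.
Local Open Scope ring_scope.

(* Solution y of y(n) = b(n) y(n-1) + a(n) y(n-2), n >= 1, with y(-1) = ym1 and
   y(0) = y0.  Only n >= 0 is indexed, and the value a 0 is never used. *)
Fixpoint cf_rec (K : comNzRingType) (b a : nat -> K) (ym1 y0 : K) (n : nat) : K :=
  if n is m.+1 then
    b m.+1 * cf_rec b a ym1 y0 m
    + a m.+1 * (if m is k.+1 then cf_rec b a ym1 y0 k else ym1)
  else y0.

(* Numerators and denominators of the convergents of
   b(0) + a(1) / (b(1) + a(2) / (b(2) + ...)). *)
Definition cf_num (K : comNzRingType) (b a : nat -> K) : nat -> K :=
  cf_rec b a 1 (b 0%N).
Definition cf_den (K : comNzRingType) (b a : nat -> K) : nat -> K :=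
  cf_rec b a 0 1.

(* The coefficients are defined for u, v in an arbitrary commutative ring, so
   that they can be taken both at the indeterminates of Z[u, v] and at reals. *)
Definition c2 (K : comNzRingType) (u v : K) (nu : nat) : K :=
  let tau : K := nu.+1%:R in
  - tau * (tau + 1) ^+ 2 * (2 * tau - 1)
  * (- 3 * (2 * tau - 1) ^+ 2 * u ^+ 2
     - (10 * tau ^+ 2 - 10 * tau + 3) * u * v
     + 2 * (3 * tau ^+ 4 - 6 * tau ^+ 3 + 4 * tau ^+ 2 - tau) * v ^+ 2).

Definition c1 (K : comNzRingType) (u v : K) (nu : nat) : K :=
  let tau : K := nu.+1%:R in
  - 12 * (68 * tau ^+ 6 - 45 * tau ^+ 4 + 12 * tau ^+ 2 - 1) * u ^+ 2
  - 8 * (157 * tau ^+ 6 - 106 * tau ^+ 4 + 30 * tau ^+ 2 - 3) * u * v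
  + 4 * (102 * tau ^+ 8 - 170 * tau ^+ 6 + 89 * tau ^+ 4 - 24 * tau ^+ 2 + 3)
      * v ^+ 2.

Definition c0 (K : comNzRingType) (u v : K) (nu : nat) : K :=
  let tau : K := nu.+1%:R in
  tau * (tau - 1) ^+ 2 * (2 * tau + 1)
  * (3 * (4 * tau ^+ 2 + 4 * tau + 1) * u ^+ 2
     + (10 * tau ^+ 2 + 10 * tau + 3) * u * v
     - 2 * (3 * tau ^+ 4 + 6 * tau ^+ 3 + 4 * tau ^+ 2 + tau) * v ^+ 2).

Definition coef_b (K : comNzRingType) (u v : K) (n : nat) : K :=
  match n with
  | 0 => 4 * (3 * u + 2 * v)
  | 1 => 34 * u + 52 * v
  | nu.+1 => - c1 u v nu
  end.

Definition coef_a (K : comNzRingType) (u v : K) (n : nat) : K :=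
  match n with
  | 0 => 0
  | 1 => (u + v) * (327 * u + 500 * v) - coef_b u v 0 * coef_b u v 1
  | 2 => - (u + v) * c0 u v 1
  | nu.+1 => - c0 u v nu * c2 u v nu.-1
  end.

Definition Pcf (K : comNzRingType) (u v : K) : nat -> K :=
  cf_num (coef_b u v) (coef_a u v).
Definition Qcf (K : comNzRingType) (u v : K) : nat -> K :=
  cf_den (coef_b u v) (coef_a u v).

(* Importing mpoly only inside this module keeps its notations, which clash with
   those of MathComp-Analysis, out of the rest of the development. *)
Module Bivariate.
Import mpoly.

Definition Zuv : comNzRingType := {mpoly int[2]}.

Definition iu : 'I_2 := ord0.
Definition iv : 'I_2 := ord_max.
Definition Xu : Zuv := ('X_iu : {mpoly int[2]}).
Definition Xv : Zuv := ('X_iv : {mpoly int[2]}).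

(* The coordinate analogue of msize: 1 + the degree in the i-th indeterminate,
   and 0 for the zero polynomial. *)
Definition size_in (i : 'I_2) (p : {mpoly int[2]}) : nat :=
  (\max_(m <- msupp p) (m i).+1)%N.

Definition size_tot (p : {mpoly int[2]}) : nat := msize p.

Definition homogeneous (p : {mpoly int[2]}) : Prop :=
  exists d : nat, p \is d.-homog.

End Bivariate.
Export Bivariate.

From mathcomp Require Import boolp classical_sets reals topology normedtype
  sequences.
Import numFieldNormedType.Exports.
Local Open Scope classical_set_scope.

Definition zeta3 (R : realType) : R :=
  limn (series (fun n : nat => n.+1%:R ^- 3 : R)).

Definition beta_star (r nu : nat) : nat :=
  (\sum_(0 <= k < nu.+2) k ^ r * ('C(nu.+1, k) * 'C(nu + k, k)) ^ 2)%N.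

Definition frakB (R : realType) : set R :=
  [set y | exists nu : nat, y = - ((beta_star 2 nu)%:R / (beta_star 1 nu)%:R)].

Definition Delta (R : realType) (x : R) : R :=
  18 * x ^+ 2 * (2 * x + 1) + (7 * x + 3) ^+ 2.

Definition rho (R : realType) (k : nat) (x : R) : R :=
  (5 * x + 3 + (-1) ^+ k * Num.sqrt (Delta x)) / (x * (3 * x + 2)).

Definition frakA (R : realType) : set R :=
  [set y | exists nu k : nat,
     [/\ (1 <= nu)%N, (1 <= k <= 2)%N & y = rho k (2 * nu * nu.+1)%N%:R]].

(* Main.v *)
(* Write A_n, B_n for the Apery numbers and their companions, so that
   B_n / A_n -> zeta(3) and n^3 (B_n A_(n-1) - B_(n-1) A_n) = 6.  With n = nu + 1,
   the sequences
     Y_nu = 3 n F (W_n - W_(n-1)) + 2 n^2 G (W_n + W_(n-1)),   W = A or B,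
   solve c_2 Y_(nu+1) + c_1 Y_nu + c_0 Y_(nu-1) = 0; hence, up to the product of
   the c_2(j), they are the denominators (W = A) and numerators (W = B) of the
   continued fraction, the latter with the additional factor 8 (F + G).  If F + G
   and G do not have opposite signs then neither do F + G and Y (for W = A), with
   |Y_nu| >= 3 n |F + G|, so that the denominators vanish only through some
   c_2(j), which is the case G / F in frakA; and by the Casoratian the quotient of
   the two Y differs from B_n / A_n by O(1 / n).  The degrees follow from
   homogeneity and from the nonvanishing at (1, 0) and (0, 1). *)
Require Import Defs.
From mathcomp Require Import all_boot all_order all_algebra.
From mathcomp Require mpoly.
From mathcomp Require Import ring lra zify.

Set Implicit Arguments.
Unset Strict Implicit.
Unset Printing Implicit Defensive.

Import Order.TTheory GRing.Theory Num.Theory.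
Local Open Scope ring_scope.

(** * Products of binomial coefficients and their contiguous relations *)

Section Apery.
Variable K : realFieldType.
Implicit Types (n k m : nat) (F G : K).

Definition binprod n k : K := ('C(n, k) * 'C(n + k, k))%:R.

Lemma binprod_small n k : (n < k)%N -> binprod n k = 0.
Proof. by move=> lt_nk; rewrite /binprod bin_small. Qed.

Lemma binprod_ge1 n k : (k <= n)%N -> 1 <= binprod n k.
Proof.
by move=> le_kn; rewrite /binprod ler1n muln_gt0 !bin_gt0 le_kn leq_addl.
Qed.

Lemma binprod_neq0 n k : (k <= n)%N -> binprod n k != 0.
Proof. by move=> /binprod_ge1 h; rewrite gt_eqF// (lt_le_trans ltr01). Qed.

Lemma binprod0 n : binprod n 0 = 1.
Proof. by rewrite /binprod !bin0. Qed.

(** Each binomial has a shift rule in n with factor n + 1, and these factors cancel in the product;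
    at k = n + 1 both sides are 0. *)
Lemma binprodSl n k :
  (n.+1%:R - k%:R) * binprod n.+1 k = (n.+1%:R + k%:R) * binprod n k.
Proof.
have [lt_nk | le_kn] := ltnP n.+1 k.
  by rewrite !binprod_small// ?mulr0// ltnW.
rewrite -natrB// -natrD /binprod -!natrM; congr _%:R.
have := mul_bin_down n.+1 k; have := mul_bin_down (n + k).+1 k; rewrite -addSn /=.
have -> : (n.+1 + k - k = n.+1)%N by lia.
move: 'C(n.+1, k) 'C(n, k) 'C(n.+1 + k, k) 'C(n + k, k) => a b c d h1 h2.
apply/eqP; rewrite -(eqn_pmul2l (ltn0Sn n)); apply/eqP.
transitivity ((n.+1 - k) * a * (n.+1 * c))%N; first by ring.
by rewrite -h1 -h2; ring.
Qed.

Lemma binprodSr n k :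
  k.+1%:R ^+ 2 * binprod n k.+1 =
    (n%:R + k.+1%:R) * (n%:R - k%:R) * binprod n k.
Proof.
have [lt_nk | le_kn] := ltnP n k.
  by rewrite !binprod_small// ?mulr0// ltnW.
rewrite -natrB// -natrD /binprod -natrX -!natrM; congr _%:R.
have := mul_bin_left n k; have := mul_bin_diag (n + k).+1 k.
rewrite addnS /=.
move: 'C(n, k.+1) 'C(n, k) 'C((n+k).+1, k.+1) 'C(n + k, k) => a b c d.
move=> h1 h2; rewrite expnS expn1.
transitivity ((k.+1 * a) * (k.+1 * c))%N; first by ring.
by rewrite h2 -h1; ring.
Qed.

(* A common factor e makes the certificate identities below polynomial, including
   at the boundary values k = n + 1 and k = n + 2, where some terms vanish. *)
Lemma binprod_common n k : (k <= n.+2)%N -> exists e : K,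
  [/\ binprod n k = (n.+2%:R - k%:R) * (n.+1%:R - k%:R) * e,
      binprod n.+1 k = (n.+1%:R + k%:R) * (n.+2%:R - k%:R) * e,
      binprod n.+2 k = (n.+1%:R + k%:R) * (n.+2%:R + k%:R) * e &
      (0 < k)%N -> binprod n.+1 k.-1 = k%:R ^+ 2 * e].
Proof.
have nz m : m.+1%:R != 0 :> K by rewrite pnatr_eq0.
have nzD m j : m.+1%:R + j%:R != 0 :> K by rewrite -natrD pnatr_eq0.
rewrite leq_eqVlt => /orP[/eqP -> | lt_k].
  (* At k = n + 2 the first two products vanish whatever e is, so e is read off the third; for
     smaller k it is read off the second. *)
  exists (binprod n.+2 n.+2 / ((n.+1%:R + n.+2%:R) * (n.+2%:R + n.+2%:R))).
  split.
  - by rewrite binprod_small// subrr !mul0r.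
  - by rewrite binprod_small// subrr mulr0 mul0r.
  - by rewrite mulrC divfK// mulf_neq0.
  move=> _ /=; have := binprodSr n.+2 n.+1; have := binprodSl n.+1 n.+1.
  have -> : n.+2%:R - n.+1%:R = 1 :> K by rewrite -natrB// subSn// subnn.
  rewrite mul1r mulr1 => -> h2; rewrite mulrA h2.
  have h3 := nzD n n.+2; have h4 := nzD n.+1 n.+2.
  rewrite (addrC n.+2%:R n.+1%:R).
  by move: (_ + _) (n.+2%:R + _) h3 h4 => x y h3 h4; field; rewrite h3 h4.
have nzB : n.+2%:R - k%:R != 0 :> K.
  by rewrite -natrB ?(ltnW lt_k)// pnatr_eq0 subn_eq0 -ltnNge.
exists (binprod n.+1 k / ((n.+1%:R + k%:R) * (n.+2%:R - k%:R))).
have h1 := binprodSl n k; have h2 := binprodSl n.+1 k.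
split.
- apply: (mulfI (nzD n k)); rewrite -h1.
  move: (_ + _) (n.+2%:R - _) (nzD n k) nzB => a b ha hb.
  by field; rewrite ha hb.
- by rewrite mulrC divfK// mulf_neq0.
- apply: (mulfI nzB); rewrite h2.
  move: (n.+1%:R + _) (n.+2%:R - _) (nzD n k) nzB => a b ha hb.
  by field; rewrite ha hb.
- case: k lt_k nzB {h1 h2} => // k lt_k nzB _ /=.
  have h := binprodSr n.+1 k; rewrite mulrA h.
  have -> : n.+1%:R - k%:R = n.+2%:R - k.+1%:R :> K by rewrite -!natrB//; lia.
  move: (_ + _) (n.+2%:R - _) (nzD n k.+1) nzB => a b ha hb.
  by field; rewrite ha hb.
Qed.

(** * The Apery numbers and their companions *)

Definition aperyA n : K := \sum_(0 <= k < n.+1) binprod n k ^+ 2.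
Definition harm3 n : K := \sum_(0 <= m < n) m.+1%:R ^- 3.
(* The m-th term is 0, not infinite, when m >= n, as then binprod n m.+1 = 0. *)
Definition apery_c n k : K :=
  harm3 n + \sum_(0 <= m < k) (-1) ^+ m / (2 * m.+1%:R ^+ 3 * binprod n m.+1).
Definition aperyB n : K := \sum_(0 <= k < n.+1) binprod n k ^+ 2 * apery_c n k.

Lemma apery_cS n k :
  apery_c n k.+1 = apery_c n k + (-1) ^+ k / (2 * k.+1%:R ^+ 3 * binprod n k.+1).
Proof. by rewrite /apery_c big_nat_recr//= addrA. Qed.

(** The difference starts, at k = 0, as the new summand 1 / (n + 1)^3 of [harm3], and each further
    pair of correction terms again gives a single fraction. *)
Lemma apery_c_diff n k : (k <= n)%N ->
  apery_c n.+1 k - apery_c n k =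
    (-1) ^+ k / (n.+1%:R ^+ 2 * (n.+1%:R + k%:R) * binprod n k).
Proof.
have nz m : m.+1%:R != 0 :> K by rewrite pnatr_eq0.
have nzD m j : m.+1%:R + j%:R != 0 :> K by rewrite -natrD pnatr_eq0.
elim: k => [|k IHk] le_kn.
  rewrite /apery_c !big_nil !addr0 /harm3 big_nat_recr//= binprod0.
  rewrite addrAC subrr add0r expr0.
  by move: (n.+1%:R) (nz n) => x hx; field.
have := IHk (ltnW le_kn); rewrite !apery_cS.
have h1 := binprodSl n k.+1; have h2 := binprodSr n k.
have nzx := @binprod_neq0 n k (ltnW le_kn).
have nzB : n%:R - k%:R != 0 :> K.
  by rewrite -natrB ?(ltnW le_kn)// pnatr_eq0 subn_eq0 -ltnNge.
have {}h2 : binprod n k.+1 =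
    (n%:R + k.+1%:R) * (n%:R - k%:R) * binprod n k / k.+1%:R ^+ 2.
  by rewrite -h2 mulrC mulKf// expf_neq0.
have {}h1 : binprod n.+1 k.+1 = (n.+1%:R + k.+1%:R) * binprod n k.+1 / (n%:R - k%:R).
  rewrite -h1 -(addn1 k) -(addn1 n) !natrD opprD addrACA subrr addr0.
  by rewrite mulrC mulKf.
rewrite h1 h2 [(-1) ^+ k.+1]exprS => /eqP; rewrite subr_eq => /eqP ->.
move: (nz n) (nz k) (nzD n k) (nzD n k.+1) nzB.
rewrite -(addn1 k) -(addn1 n) !natrD.
move: (apery_c n k) (binprod n k) nzx ((-1) ^+ k) (n%:R) (k%:R).
move=> c x nzx s a b na nb nab nab1 nzB.
have eqab : a + (b + 1) = a + 1 + b by ring.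
by field; rewrite eqab nb nzx nzB nab nab1 na.
Qed.

(** With V (-1) read as 0, the partial sums of T are the values of V, so only the last value has to
    vanish. *)
Lemma sumr_cert (T V : nat -> K) N :
    (forall k, (k <= N)%N -> T k = V k - (if k is j.+1 then V j else 0)) ->
  V N = 0 -> \sum_(0 <= k < N.+1) T k = 0.
Proof.
move=> hT VN0.
suff H M : (M <= N)%N -> \sum_(0 <= k < M.+1) T k = V M by rewrite H.
elim: M => [|M IHM] le_MN; first by rewrite big_nat1 hT// subr0.
by rewrite big_nat_recr//= IHM ?(ltnW le_MN)// hT// addrC subrK.
Qed.

Lemma sum_binprod_widen n N (f : nat -> K) : (n < N)%N ->
  \sum_(0 <= k < n.+1) binprod n k ^+ 2 * f k =
  \sum_(0 <= k < N) binprod n k ^+ 2 * f k.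
Proof.
move=> lt_nN; rewrite (big_cat_nat (n := n.+1) _ lt_nN)//=.
rewrite [X in _ + X]big1_seq ?addr0// => k /=.
by rewrite mem_index_iota => /andP[lt_nk _]; rewrite binprod_small// expr0n mul0r.
Qed.

(** * Apery's recurrence by creative telescoping *)

Definition apery_poly (x : K) : K := (2 * x + 1) * (17 * x ^+ 2 + 17 * x + 5).

(* Creative telescoping certificate of Zagier and Cohen; see van der Poorten. *)
Definition aperyA_cert n k : K :=
  4 * (2 * n%:R + 1) * (k%:R * (2 * k%:R + 1) - (2 * n%:R + 1) ^+ 2)
  * binprod n k ^+ 2.

Lemma aperyA_rec_term n k : (k <= n.+2)%N ->
  n.+2%:R ^+ 3 * binprod n.+2 k ^+ 2 - apery_poly n.+1%:R * binprod n.+1 k ^+ 2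
    + n.+1%:R ^+ 3 * binprod n k ^+ 2 =
  aperyA_cert n.+1 k - (if k is j.+1 then aperyA_cert n.+1 j else 0).
Proof.
move=> le_k; have [e [h0 h1 h2 h3]] := binprod_common le_k.
rewrite /apery_poly /aperyA_cert h0 h1 h2.
case: k {le_k h0 h1 h2} h3 => [_|k /(_ isT) /= ->].
  by rewrite -(addn1 n.+1) -(addn1 n) !natrD; ring.
by rewrite -(addn1 n.+1) -(addn1 n) -(addn1 k) !natrD; ring.
Qed.

Definition apery_recurrence (W : nat -> K) := forall n,
  n.+2%:R ^+ 3 * W n.+2 = apery_poly n.+1%:R * W n.+1 - n.+1%:R ^+ 3 * W n.

Lemma aperyA_rec : apery_recurrence aperyA.
Proof.
move=> n; apply/eqP; rewrite -subr_eq0 opprB addrA; apply/eqP.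
have E m : (m < n.+3)%N -> aperyA m = \sum_(0 <= k < n.+3) binprod m k ^+ 2 * 1.
  by move=> lt_m; rewrite -sum_binprod_widen//; apply: eq_bigr => k _; rewrite mulr1.
rewrite !E; try lia.
rewrite addrAC !mulr_sumr -sumrB -big_split /=.
apply: (@sumr_cert _ (aperyA_cert n.+1)) => [k le_k|].
  by rewrite !mulr1 aperyA_rec_term.
by rewrite /aperyA_cert binprod_small// expr0n mulr0.
Qed.

(** The certificate for A weighted by [apery_c], with a correction for the variation of [apery_c] in
    n and k. *)
Definition aperyB_cert n k : K :=
  aperyA_cert n k * apery_c n k
  - 5 * (2 * n%:R + 1) * (-1) ^+ k * k%:R / (n%:R * (n%:R + 1)) * binprod n k.

Lemma aperyB_rec_term n k : (k <= n.+2)%N ->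
  n.+2%:R ^+ 3 * (binprod n.+2 k ^+ 2 * apery_c n.+2 k)
    - apery_poly n.+1%:R * (binprod n.+1 k ^+ 2 * apery_c n.+1 k)
    + n.+1%:R ^+ 3 * (binprod n k ^+ 2 * apery_c n k) =
  aperyB_cert n.+1 k - (if k is j.+1 then aperyB_cert n.+1 j else 0).
Proof.
have nz m : m.+1%:R != 0 :> K by rewrite pnatr_eq0.
have nzD m j : m.+1%:R + j%:R != 0 :> K by rewrite -natrD pnatr_eq0.
move=> le_k; have [e [h0 h1 h2 h3]] := binprod_common le_k.
(* The square of [binprod n k] clears the denominator, so the relation also holds for k > n, where
   both sides are 0. *)
have Dm : binprod n k ^+ 2 * apery_c n k = binprod n k ^+ 2 * apery_c n.+1 k
    - (-1) ^+ k * binprod n k / (n.+1%:R ^+ 2 * (n.+1%:R + k%:R)).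
  have [le_kn|lt_nk] := leqP k n; last first.
    by rewrite binprod_small// expr0n !mul0r mulr0 mul0r subrr.
  have := apery_c_diff le_kn; move: (binprod n k) (binprod_neq0 le_kn) => x hx.
  move/eqP; rewrite subr_eq => /eqP ->.
  move: (n.+1%:R) (n.+1%:R + _) (nz n) (nzD n k) => a b ha hb.
  by field; rewrite ha hb hx.
rewrite Dm.
(* At k = n + 2 only the top product survives; [apery_c n.+2 k] is first lowered to index n + 1, the
   last one at which levels n + 1 and n + 2 can be compared. *)
have [|lt_k] := leqP k n.+1; last first.
  have {le_k lt_k} ek : k = n.+2 by apply/eqP; rewrite eqn_leq le_k lt_k.
  rewrite ek /= in h0 h1 h2 h3 *; have {}h3 := h3 isT.
  rewrite h0 h1 h2 subrr !(mul0r, mulr0, expr0n, subr0, addr0, sub0r) /=.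
  rewrite /aperyB_cert /aperyA_cert (@binprod_small n.+1 n.+2)// apery_cS.
  have /eqP := apery_c_diff (leqnn n.+1); rewrite subr_eq => /eqP ->.
  rewrite h2 h3 expr0n /= !(mulr0, mul0r, subr0, sub0r).
  have nze : e != 0.
    by apply: contraTneq (binprod_neq0 (leqnn n.+1)) => e0; rewrite h3 e0 mulr0 eqxx.
  move: nze (nzD n n.+2) (nzD n.+1 n.+2) (nz n) (nz n.+1) (nzD n.+1 n.+1).
  rewrite -(addn1 n.+1) -(addn1 n) !natrD.
  move: (apery_c _ _) (n%:R) => c a nze H1 H2 H3 H4 H5.
  by field; rewrite H1 H2 H3 H4 nze.
move=> {}le_k.
have nzB : n.+2%:R - k%:R != 0 :> K.
  by rewrite -natrB ?(leqW le_k)// pnatr_eq0 subn_eq0 -ltnNge ltnS.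
have /eqP := apery_c_diff le_k; rewrite subr_eq => /eqP ->.
have nze : e != 0.
  by apply: contraTneq (binprod_neq0 le_k) => e0; rewrite h1 e0 mulr0 eqxx.
case: k le_k nzB h0 h1 h2 h3 {Dm} => [|k] le_k nzB h0 h1 h2 h3.
  rewrite /aperyB_cert /aperyA_cert h0 h1 h2 /apery_poly expr0.
  move: nze (nz n) (nz n.+1).
  rewrite -(addn1 n.+1) -(addn1 n) !natrD.
  move: (apery_c _ _) (n%:R) => c a H1 H2 H3.
  by field; rewrite H1 H2 H3.
(* Once [apery_c n.+1 k] is expressed through index k + 1, a rational identity with one unknown
   value of [apery_c] is left. *)
rewrite /aperyB_cert; have /eqP := apery_cS n.+1 k; rewrite -subr_eq => /eqP <-.
rewrite /aperyA_cert h0 h1 h2 (h3 isT) /apery_poly [(-1) ^+ k.+1]exprS.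
move: nze nzB (nzD n k.+1) (nzD n.+1 k.+1) (nz k) (nz n) (nz n.+1).
rewrite -(addn1 n.+1) -(addn1 n) -(addn1 k) !natrD.
move: (apery_c _ _) ((-1) ^+ k) (n%:R) (k%:R) => c s a b nze H1 H2 H3 H4 H5 H6.
by field; rewrite nze H1 H2 H3 H4 H5 H6.
Qed.

Lemma aperyB_rec : apery_recurrence aperyB.
Proof.
move=> n; apply/eqP; rewrite -subr_eq0 opprB addrA; apply/eqP.
have E m : (m < n.+3)%N ->
    aperyB m = \sum_(0 <= k < n.+3) binprod m k ^+ 2 * apery_c m k.
  by move=> lt_m; rewrite -sum_binprod_widen.
rewrite !E; try lia.
rewrite addrAC !mulr_sumr -sumrB -big_split /=.
apply: (@sumr_cert _ (aperyB_cert n.+1)) => [k le_k|].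
  by rewrite aperyB_rec_term.
by rewrite /aperyB_cert /aperyA_cert binprod_small// expr0n !mulr0 !mul0r subrr.
Qed.

(** * Initial values, Casoratian and growth *)

Lemma aperyA0 : aperyA 0 = 1.
Proof. by rewrite /aperyA big_nat1 binprod0 expr1n. Qed.

Lemma aperyA1 : aperyA 1 = 5.
Proof.
by rewrite /aperyA !big_nat_recr//= big_nil binprod0 (_ : binprod 1 1 = 2)//; ring.
Qed.

Lemma aperyB0 : aperyB 0 = 0.
Proof. by rewrite /aperyB big_nat1 /apery_c /harm3 !big_nil addr0 mulr0. Qed.

Lemma aperyB1 : aperyB 1 = 6.
Proof.
rewrite /aperyB !big_nat_recr//= big_nil /apery_c /harm3 !big_nat1 big_nil.
by rewrite binprod0 (_ : binprod 1 1 = 2)// expr0; field.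
Qed.

Lemma aperyA2 : aperyA 2 = 73.
Proof.
have n8 : 2%:R ^+ 3 != 0 :> K by rewrite -natrX pnatr_eq0.
by apply: (mulfI n8); rewrite aperyA_rec aperyA1 aperyA0 /apery_poly; ring.
Qed.

Lemma aperyB2 : aperyB 2 = 351 / 4.
Proof.
have n8 : 2%:R ^+ 3 != 0 :> K by rewrite -natrX pnatr_eq0.
by apply: (mulfI n8); rewrite aperyB_rec aperyB1 aperyB0 /apery_poly; field.
Qed.

(** Cross-multiplying the two recurrences cancels the middle coefficient; the outer ones are
    consecutive cubes, so the weighted Casoratian keeps its initial value 6. *)
Lemma apery_casoratian n :
  n.+1%:R ^+ 3 * (aperyB n.+1 * aperyA n - aperyB n * aperyA n.+1) = 6.
Proof.
elim: n => [|n IHn]; first by rewrite aperyA0 aperyB0 aperyB1; ring.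
rewrite mulrBr !mulrA aperyB_rec (mulrAC _ (aperyB n.+1)) aperyA_rec.
by rewrite -IHn; ring.
Qed.

Lemma binprod_ge0 n k : 0 <= binprod n k.
Proof. exact: ler0n. Qed.

Lemma binprod_leSl n k : binprod n k <= binprod n.+1 k.
Proof. by rewrite /binprod ler_nat leq_mul// leq_bin2l// leq_add2r. Qed.

(** The old terms do not decrease, and the new term k = n + 1 is at least 1. *)
Lemma aperyA_leS n : aperyA n + 1 <= aperyA n.+1.
Proof.
rewrite /aperyA [leRHS]big_nat_recr//=; apply: lerD.
  by apply: ler_sum => k _; rewrite lerXn2r ?nnegrE ?binprod_ge0 ?binprod_leSl.
by rewrite expr_ge1 ?binprod_ge0 ?binprod_ge1.
Qed.

Lemma aperyA_ge1 n : 1 <= aperyA n.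
Proof.
case: n => [|n]; first by rewrite aperyA0.
apply: le_trans (aperyA_leS n); rewrite lerDr.
by apply: sumr_ge0 => k _; rewrite sqr_ge0.
Qed.

Lemma aperyA_gt0 n : 0 < aperyA n.
Proof. exact: lt_le_trans ltr01 (aperyA_ge1 n). Qed.

Lemma aperyB_cross n : aperyB n * aperyA n.+1 < aperyB n.+1 * aperyA n.
Proof.
rewrite -subr_gt0 -(@pmulr_rgt0 _ (n.+1%:R ^+ 3)) ?apery_casoratian//.
by rewrite exprn_gt0.
Qed.

Lemma aperyB_ge0 n : 0 <= aperyB n.
Proof.
elim: n => [|n IHn]; first by rewrite aperyB0.
rewrite -(pmulr_lge0 _ (aperyA_gt0 n)); apply: le_trans (ltW (aperyB_cross n)).
by rewrite mulr_ge0// ltW// aperyA_gt0.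
Qed.

Lemma aperyB_ltS n : aperyB n < aperyB n.+1.
Proof.
rewrite -(ltr_pM2r (aperyA_gt0 n)); apply: le_lt_trans (aperyB_cross n).
rewrite ler_wpM2l ?aperyB_ge0//; apply: le_trans (aperyA_leS n).
by rewrite lerDl.
Qed.

(** * The sequences Y and the convergents *)

Definition apery_mix (F G : K) (W : nat -> K) n : K :=
  (2 * n.+1%:R ^+ 2 * G + 3 * n.+1%:R * F) * W n.+1
  + (2 * n.+1%:R ^+ 2 * G - 3 * n.+1%:R * F) * W n.

(** The recurrence eliminates [W n.+3] and [W n]; the coefficients of the two remaining values then
    agree identically. *)
Lemma apery_mix_rec F G W n : apery_recurrence W ->
  c2 F G n.+1 * apery_mix F G W n.+2 =
    - c1 F G n.+1 * apery_mix F G W n.+1 - c0 F G n.+1 * apery_mix F G W n.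
Proof.
have nz m : m.+1%:R != 0 :> K by rewrite pnatr_eq0.
move=> recW; rewrite /apery_mix /c0 /c1 /c2 /=.
have W3 : W n.+3 = (apery_poly n.+2%:R * W n.+2 - n.+2%:R ^+ 3 * W n.+1)
                   / n.+3%:R ^+ 3.
  by rewrite -recW mulrC mulKf// expf_neq0.
have W0 : W n = (apery_poly n.+1%:R * W n.+1 - n.+2%:R ^+ 3 * W n.+2)
                   / n.+1%:R ^+ 3.
  by rewrite recW opprB addrC subrK mulrC mulKf// expf_neq0.
rewrite W3 W0 /apery_poly; move: (nz n) (nz n.+1) (nz n.+2).
rewrite -(addn1 n.+2) -(addn1 n.+1) -(addn1 n) !natrD.
move: (n%:R) (W n.+1) (W n.+2) => a w1 w2 h1 h2 h3.
by field; rewrite h1 h3.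
Qed.

(** The normalising factor that makes the recurrence for Y monic in its leading term, at the price
    of the factor c_2 in the partial numerators. *)
Definition c2_prod (F G : K) n : K := \prod_(1 <= j < n) c2 F G j.

(** The partial numerator a(2) has F + G where the later ones have a value of c_2; hence the factor
    F + G in the condition at index 0, and a formula that starts at index 1. *)
Lemma cf_recE F G (W : nat -> K) ym1 y0 (kappa : K) :
    apery_recurrence W ->
    let X := cf_rec (coef_b F G) (coef_a F G) ym1 y0 in
    (F + G) * y0 = kappa * apery_mix F G W 0 -> X 1%N = kappa * apery_mix F G W 1 ->
  forall n, X n.+1 = kappa * c2_prod F G n.+1 * apery_mix F G W n.+1.
Proof.
move=> recW X X0 X1.
have P1 : c2_prod F G 1 = 1 by rewrite /c2_prod big_geq.
have PS n : c2_prod F G n.+2 = c2_prod F G n.+1 * c2 F G n.+1.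
  by rewrite /c2_prod big_nat_recr.
have XS n : X n.+2 = coef_b F G n.+2 * X n.+1 + coef_a F G n.+2 * X n by [].
suff H n : X n.+1 = kappa * c2_prod F G n.+1 * apery_mix F G W n.+1 /\
           X n.+2 = kappa * c2_prod F G n.+2 * apery_mix F G W n.+2.
  by move=> n; case: (H n).
elim: n => [|n [IH1 IH2]]; split=> //.
- by rewrite P1 mulr1.
- rewrite XS X1 PS P1 mul1r -mulrA (apery_mix_rec _ _ _ recW).
  rewrite /coef_a /coef_b (_ : X 0%N = y0)//.
  move: (c1 _ _ _) (c0 _ _ _) (apery_mix _ _ _ _) X0 => c c' M X0.
  rewrite (_ : - (F + G) * c' * y0 = - c' * ((F + G) * y0)); last by ring.
  by rewrite X0; ring.
- have -> : kappa * c2_prod F G n.+3 * apery_mix F G W n.+3 =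
      kappa * c2_prod F G n.+2 * (c2 F G n.+2 * apery_mix F G W n.+3).
    by rewrite (PS n.+1) !mulrA.
  rewrite (apery_mix_rec _ _ _ recW) XS IH2 IH1 (PS n) /coef_a /coef_b /=.
  move: (c1 _ _ _) (c0 _ _ _) (c2 _ _ _) (c2_prod _ _ _) => c c' c'' d.
  by ring.
Qed.

(** Writing F = (F + G) - G splits the product into multiples of (F + G)^2 and of (F + G) G with
    nonnegative coefficients. *)
Lemma apery_mixA_gt0 F G n : 0 <= (F + G) * G ->
  3 * n.+1%:R * (F + G) ^+ 2 <= (F + G) * apery_mix F G aperyA n.
Proof.
move=> hG; set a : K := n.+1%:R.
have a1 : 1 <= a by rewrite ler1n.
have -> : (F + G) * apery_mix F G aperyA n =
    3 * a * (F + G) ^+ 2 * (aperyA n.+1 - aperyA n)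
    + a * ((F + G) * G) * ((2 * a - 3) * aperyA n.+1 + (2 * a + 3) * aperyA n).
  by rewrite /apery_mix -/a; ring.
have hA := aperyA_leS n; have hA1 := aperyA_ge1 n.
have h0 : 0 <= 3 * a * (F + G) ^+ 2.
  by rewrite mulr_ge0 ?sqr_ge0// mulr_ge0// (le_trans ler01 a1).
rewrite -[leLHS]addr0; apply: lerD.
  by rewrite ler_peMr//; lra.
apply: mulr_ge0; first by rewrite mulr_ge0// (le_trans ler01 a1).
(* Only at n = 0 is 2 a - 3 negative, and there the bracket is -5 + 5 = 0. *)
rewrite /a; case: {a a1 h0} n hA hA1 => [|n] hA hA1.
  by rewrite aperyA0 aperyA1; lra.
have a2 : 2 <= n.+2%:R :> K by rewrite ler_nat.
by nra.
Qed.

(** The terms of index n + 1 cancel, leaving the Casoratian; this compares the quotient of the two Y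
    with B / A. *)
Lemma apery_mixAB F G n :
  n.+1%:R ^+ 3 * (apery_mix F G aperyB n * aperyA n.+1
                    - apery_mix F G aperyA n * aperyB n.+1) =
  - 6 * (2 * n.+1%:R ^+ 2 * G - 3 * n.+1%:R * F).
Proof. by rewrite -(apery_casoratian n) /apery_mix; ring. Qed.

(** For A, Y_0 = 12 (F + G), while Q(0) = 1. *)
Lemma QcfS F G n :
  Qcf F G n.+1 = 12^-1 * c2_prod F G n.+1 * apery_mix F G aperyA n.+1.
Proof.
apply: (cf_recE aperyA_rec).
  by rewrite /apery_mix aperyA0 aperyA1; field.
by rewrite /apery_mix aperyA2 aperyA1 /=; field.
Qed.

(** For B, Y_0 = 6 (3 F + 2 G), while P(0) = 4 (3 F + 2 G). Divided by 1 / 12, the constant gives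
    the factor 8 (F + G) of the limit. *)
Lemma PcfS F G n :
  Pcf F G n.+1 = 2 / 3 * (F + G) * c2_prod F G n.+1 * apery_mix F G aperyB n.+1.
Proof.
apply: (cf_recE aperyB_rec).
  by rewrite /apery_mix aperyB0 aperyB1 /=; field.
by rewrite /apery_mix aperyB2 aperyB1 /=; field.
Qed.

Lemma c2_prod_neq0 F G n : (forall j, (0 < j)%N -> c2 F G j != 0) ->
  c2_prod F G n != 0.
Proof.
move=> hc; rewrite /c2_prod prodf_seq_neq0; apply/allP => j /=.
by rewrite mem_index_iota => /andP[+ _]; apply: hc.
Qed.

Lemma Qcf_neq0 F G n : F + G != 0 -> 0 <= (F + G) * G ->
  (forall j, (0 < j)%N -> c2 F G j != 0) -> Qcf F G n != 0.
Proof.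
move=> hFG hG hc; case: n => [|n]; first exact: oner_neq0.
rewrite QcfS !mulf_neq0 ?invr_neq0 ?pnatr_eq0 ?c2_prod_neq0//.
apply: contraTneq (apery_mixA_gt0 n.+1 hG) => ->; rewrite mulr0 -ltNge.
have sq_gt0 : 0 < (F + G) ^+ 2 by rewrite exprn_even_gt0.
by rewrite mulr_gt0// mulr_gt0.
Qed.

(** * Nonvanishing at (1, 0) and (0, 1) *)

Lemma c2_10_neq0 j : c2 (1 : K) 0 j != 0.
Proof.
rewrite /c2 /= -[j.+1]addn1 natrD; move: (j%:R) (ler0n K j) => a ha.
rewrite gt_eqF// [ltRHS](_ : _ =
  3 * (a + 1) * (a + 2) ^+ 2 * (2 * a + 1) * (2 * a + 1) ^+ 2); last by ring.
have a1 : 0 < a + 1 by lra.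
have a2 : 0 < a + 2 by lra.
have a3 : 0 < 2 * a + 1 by lra.
by rewrite !(mulr_gt0, exprn_gt0).
Qed.

(** The coefficient of v^2 contains tau - 1 = j, hence the condition on j; in a = j - 1 all factors
    have positive coefficients. *)
Lemma c2_01_neq0 j : (0 < j)%N -> c2 (0 : K) 1 j != 0.
Proof.
case: j => // j _; rewrite /c2 /= -[j.+2]addn2 natrD.
move: (j%:R) (ler0n K j) => a ha.
rewrite lt_eqF// -oppr_gt0 [ltRHS](_ : _ =
  2 * (a + 2) * (a + 3) ^+ 2 * (2 * a + 3)
  * ((a + 1) * (a + 2) * (3 * a ^+ 2 + 9 * a + 7))); last by ring.
have a1 : 0 < a + 1 by lra.
have a2 : 0 < a + 2 by lra.
have a3 : 0 < a + 3 by lra.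
have a4 : 0 < 2 * a + 3 by lra.
have a5 : 0 < 3 * a ^+ 2 + 9 * a + 7 by nra.
by rewrite !(mulr_gt0, exprn_gt0).
Qed.

Lemma Pcf10_neq0 n : Pcf (1 : K) 0 n != 0.
Proof.
case: n => [|n]; first by rewrite /Pcf /cf_num /= mulr0 addr0 mulr1 -natrM pnatr_eq0.
rewrite PcfS !mulf_neq0 ?invr_neq0 ?pnatr_eq0 ?c2_prod_neq0//; last first.
(* At (1, 0), Y is a positive multiple of an increment of B. *)
- rewrite /apery_mix gt_eqF// !mulr0 mulr1 add0r sub0r mulNr -mulrBr.
  by rewrite mulr_gt0 ?subr_gt0 ?aperyB_ltS// mulr_gt0.
- by move=> j _; apply: c2_10_neq0.
- by rewrite addr0 oner_neq0.
Qed.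

Lemma Pcf01_neq0 n : Pcf (0 : K) 1 n != 0.
Proof.
case: n => [|n]; first by rewrite /Pcf /cf_num /= mulr0 add0r mulr1 -natrM pnatr_eq0.
rewrite PcfS !mulf_neq0 ?invr_neq0 ?pnatr_eq0 ?c2_prod_neq0//; last first.
- rewrite /apery_mix gt_eqF// !mulr0 addr0 subr0 mulr1 -mulrDr.
  rewrite mulr_gt0 ?mulr_gt0 ?exprn_gt0//.
  by rewrite ltr_wpDr ?aperyB_ge0// (le_lt_trans (aperyB_ge0 _) (aperyB_ltS n.+1)).
- exact: c2_01_neq0.
- by rewrite add0r oner_neq0.
Qed.
End Apery.

Lemma cf_recSS (K : comNzRingType) (b a : nat -> K) ym1 y0 n :
  cf_rec b a ym1 y0 n.+2 =
  b n.+2 * cf_rec b a ym1 y0 n.+1 + a n.+2 * cf_rec b a ym1 y0 n.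
Proof. by []. Qed.

(** * Compatibility with ring morphisms *)

Section Morphism.
Variables (K L : comNzRingType) (f : {rmorphism K -> L}).

Let rmE := (rmorph_nat f, rmorph1 f, rmorph0 f,
  rmorphXn f, rmorphM f, rmorphN f, rmorphD f).

Lemma rmorph_cf_rec (b a : nat -> K) (b' a' : nat -> L) ym1 y0 n :
    (forall i, f (b i) = b' i) -> (forall i, f (a i) = a' i) ->
  f (cf_rec b a ym1 y0 n) = cf_rec b' a' (f ym1) (f y0) n.
Proof.
move=> fb fa; suff: f (cf_rec b a ym1 y0 n) = cf_rec b' a' (f ym1) (f y0) n /\
  f (cf_rec b a ym1 y0 n.+1) = cf_rec b' a' (f ym1) (f y0) n.+1 by case.
elim: n => [|n [IH1 IH2]]; first by rewrite /= !rmE fb fa.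
by split=> //; rewrite !cf_recSS rmorphD 2!rmorphM fb fa IH1 IH2.
Qed.

Lemma rmorph_c0 u v n : f (c0 u v n) = c0 (f u) (f v) n.
Proof. by rewrite /c0 !rmE. Qed.

Lemma rmorph_c1 u v n : f (c1 u v n) = c1 (f u) (f v) n.
Proof. by rewrite /c1 !rmE. Qed.

Lemma rmorph_c2 u v n : f (c2 u v n) = c2 (f u) (f v) n.
Proof. by rewrite /c2 !rmE. Qed.

Lemma rmorph_coef_b u v n : f (coef_b u v n) = coef_b (f u) (f v) n.
Proof. by case: n => [|[|n]]; rewrite /coef_b ?rmorphN ?rmorph_c1 ?rmE. Qed.

Lemma rmorph_coef_a u v n : f (coef_a u v n) = coef_a (f u) (f v) n.
Proof.
case: n => [|[|[|n]]]; rewrite /coef_a /coef_b.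
- exact: rmorph0.
- by rewrite !rmE.
- by rewrite rmorphM rmorphN rmorphD rmorph_c0.
- by rewrite rmorphM rmorphN rmorph_c0 rmorph_c2.
Qed.

Lemma rmorph_Pcf u v n : f (Pcf u v n) = Pcf (f u) (f v) n.
Proof.
rewrite /Pcf /cf_num (rmorph_cf_rec _ _ _ (rmorph_coef_b u v) (rmorph_coef_a u v)).
by rewrite rmorph1 rmorph_coef_b.
Qed.

Lemma rmorph_Qcf u v n : f (Qcf u v n) = Qcf (f u) (f v) n.
Proof.
rewrite /Qcf /cf_den (rmorph_cf_rec _ _ _ (rmorph_coef_b u v) (rmorph_coef_a u v)).
by rewrite rmorph0 rmorph1.
Qed.
End Morphism.

(** * Homogeneity and degrees *)

Module Homogeneity.
Import mpoly.

Implicit Types p q : {mpoly int[2]}.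

Lemma dhomog_nat k : (k%:R : {mpoly int[2]}) \is 0.-homog.
Proof. by rewrite rpredMn// dhomog1. Qed.

Lemma dhomog0M d p q : p \is 0.-homog -> q \is d.-homog -> p * q \is d.-homog.
Proof. by move=> hp hq; rewrite -[d]add0n dhomogM. Qed.

Lemma dhomog0Xn p k : p \is 0.-homog -> p ^+ k \is 0.-homog.
Proof. by move=> /(dhomogMn k); rewrite mul0n. Qed.

Lemma dhomog_Xu : Xu \is 1.-homog.
Proof. by rewrite dhomogX; apply/eqP/mdeg1. Qed.

Lemma dhomog_Xv : Xv \is 1.-homog.
Proof. by rewrite dhomogX; apply/eqP/mdeg1. Qed.

Lemma dhomog_quadratic (x y z : {mpoly int[2]}) :
    x \is 0.-homog -> y \is 0.-homog -> z \is 0.-homog ->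
  x * Xu ^+ 2 + y * Xu * Xv + z * Xv ^+ 2 \is 2.-homog.
Proof.
move=> hx hy hz; rewrite !rpredD// -?mulrA dhomog0M//.
- exact: (dhomogMn 2 dhomog_Xu).
- exact: (dhomogM dhomog_Xu dhomog_Xv).
- exact: (dhomogMn 2 dhomog_Xv).
Qed.

Ltac homog0 := repeat first [exact: dhomog_nat | exact: dhomog1
  | apply: rpredD | apply: dhomog0M | apply: dhomog0Xn | rewrite rpredN].

Lemma dhomog_c0 n : c0 Xu Xv n \is 2.-homog.
Proof.
rewrite /c0 -[in X in _ * X]mulNr; apply: dhomog0M; first by homog0.
by apply: dhomog_quadratic; homog0.
Qed.

Lemma dhomog_c1 n : c1 Xu Xv n \is 2.-homog.
Proof.
rewrite /c1; rewrite -!mulNr.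
by apply: dhomog_quadratic; homog0.
Qed.

Lemma dhomog_c2 n : c2 Xu Xv n \is 2.-homog.
Proof.
rewrite /c2; apply: dhomog0M; first by homog0.
rewrite -!mulNr.
by apply: dhomog_quadratic; homog0.
Qed.

Lemma dhomog_linear (x y : {mpoly int[2]}) : x \is 0.-homog -> y \is 0.-homog ->
  x * Xu + y * Xv \is 1.-homog.
Proof.
by move=> hx hy; rewrite rpredD// dhomog0M// (dhomog_Xu, dhomog_Xv).
Qed.

Lemma dhomog_coef_b0 : coef_b Xu Xv 0 \is 1.-homog.
Proof. by rewrite /coef_b mulrDr !mulrA; apply: dhomog_linear; homog0. Qed.

Lemma dhomog_coef_b1 : coef_b Xu Xv 1 \is 1.-homog.
Proof. by apply: dhomog_linear; homog0. Qed.

Lemma dhomog_coef_bSS n : coef_b Xu Xv n.+2 \is 2.-homog.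
Proof. by rewrite /coef_b rpredN dhomog_c1. Qed.

Lemma dhomog_XuDXv : Xu + Xv \is 1.-homog.
Proof. by rewrite rpredD ?dhomog_Xu ?dhomog_Xv. Qed.

Lemma dhomog_coef_a1 : coef_a Xu Xv 1 \is 2.-homog.
Proof.
rewrite /coef_a rpredB//.
  by apply: (dhomogM dhomog_XuDXv); apply: dhomog_linear; homog0.
exact: (dhomogM dhomog_coef_b0 dhomog_coef_b1).
Qed.

Lemma dhomog_coef_a2 : coef_a Xu Xv 2 \is 3.-homog.
Proof.
by rewrite /coef_a mulNr rpredN; apply: (dhomogM dhomog_XuDXv (dhomog_c0 1)).
Qed.

Lemma dhomog_coef_aSSS n : coef_a Xu Xv n.+3 \is 4.-homog.
Proof.
by rewrite /coef_a mulNr rpredN; apply: (dhomogM (dhomog_c0 _) (dhomog_c2 _)).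
Qed.

(** Each step adds 2 to the degree, as b has degree 2 and a degree 4; a(2), of degree 3, makes up
    for the rise by only 1 from index 0 to index 1. *)
Lemma dhomog_cf_rec (d : nat) (ym1 y0 : Zuv) :
    let X := cf_rec (coef_b Xu Xv) (coef_a Xu Xv) ym1 y0 in
    (y0 : {mpoly int[2]}) \is d.-homog ->
    (X 1%N : {mpoly int[2]}) \is d.+1.-homog ->
  forall n, (X n.+1 : {mpoly int[2]}) \is (n.*2 + d.+1).-homog.
Proof.
move=> X hX0 hX1 n.
suff [//] : X n.+1 \is (n.*2 + d.+1).-homog /\ X n.+2 \is (n.+1.*2 + d.+1).-homog.
elim: n => [|n [IH1 IH2]]; split=> //; rewrite /X cf_recSS rpredD//.
- exact: (dhomogM (dhomog_coef_bSS 0) hX1).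
- exact: (dhomogM dhomog_coef_a2 hX0).
- exact: (dhomogM (dhomog_coef_bSS n.+1) IH2).
- exact: (dhomogM (dhomog_coef_aSSS n) IH1).
Qed.

Lemma dhomog_Pcf n : Pcf Xu Xv n \is (maxn (2 * n) 1).-homog.
Proof.
case: n => [|n]; first exact: dhomog_coef_b0.
rewrite (_ : maxn _ _ = n.*2 + 2)%N; last by lia.
apply: dhomog_cf_rec; first exact: dhomog_coef_b0.
rewrite /= mulr1 rpredD ?dhomog_coef_a1//.
exact: (dhomogM dhomog_coef_b1 dhomog_coef_b0).
Qed.

Lemma dhomog_Qcf n : Qcf Xu Xv n \is (maxn (2 * n - 1) 0).-homog.
Proof.
case: n => [|n]; first exact: dhomog1.
rewrite (_ : maxn _ _ = n.*2 + 1)%N; last by lia.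
apply: dhomog_cf_rec; first exact: dhomog1.
by rewrite /= mulr1 mulr0 addr0; apply: dhomog_coef_b1.
Qed.

(** At the i-th unit vector every monomial of degree d except the pure power of the i-th variable
    vanishes, so that power must occur, and it attains all the maxima. *)
Lemma homog_sizes (d : nat) (p : {mpoly int[2]}) (i : 'I_2) :
    p \is d.-homog -> p.@[fun j => (j == i)%:R] != 0 ->
  size_in i p = d.+1 /\ size_tot p = d.+1.
Proof.
move=> /dhomogP hd hi.
have hp (m : 'X_{1..2}) : m \in msupp p -> mdeg m = d by apply: hd.
have /hasP[m m_p /eqP mi] : has (fun m : 'X_{1..2} => m i == d) (msupp p).
  apply: contraNT hi => /hasPn hi; rewrite mevalE big1_seq// => m /= m_p.
  suff [j ji mj] : exists2 j, j != i & m j != 0%N.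
    by rewrite (bigD1 j)//= (negPf ji) expr0n (negPf mj) mul0r mulr0.
  apply/exists_inP; apply: contraNT (hi m m_p) => /exists_inPn hm.
  rewrite -(hp m m_p) mdegE (bigD1 i)//= big1 ?addn0// => j /hm.
  by rewrite negbK => /eqP.
have le_md m' : m' \in msupp p -> (m' i <= d)%N.
  by move=> /hp <-; rewrite mdegE (bigD1 i)//= leq_addr.
have bigmaxE (h : 'X_{1..2} -> nat) : (forall m', m' \in msupp p -> (h m' <= d)%N) ->
    h m = d -> (\max_(m' <- msupp p) (h m').+1)%N = d.+1.
  move=> le_hd hm; apply/eqP; rewrite eqn_leq; apply/andP; split.
    by apply/bigmax_leqP_seq => m' m'p _; rewrite ltnS le_hd.
  rewrite -[X in (X < _)%N]hm.
  by apply: (@leq_bigmax_seq _ _ xpredT (fun m' => (h m').+1)).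
split; first exact: bigmaxE.
by rewrite /size_tot msizeE bigmaxE ?hp// => m' /hp ->.
Qed.

(** Evaluation at a unit vector and the embedding of the integers into [rat] are morphisms, so the
    results over ordered fields apply. *)
Lemma meval_Xuv (X : forall K : comNzRingType, K -> K -> nat -> K) n (i : 'I_2) :
    (forall (K L : comNzRingType) (f : {rmorphism K -> L}) u v,
       f (X K u v n) = X L (f u) (f v) n) ->
  X rat (iu == i)%:R (iv == i)%:R n != 0 ->
  (X Zuv Xu Xv n : {mpoly int[2]}).@[fun j => (j == i)%:R] != 0.
Proof.
move=> morX; apply: contra_neq => X0.
have := congr1 (fun z : int => z%:~R : rat) X0.
have eu : meval (fun j => (j == i)%:R) Xu = (iu == i)%:R by apply: mevalXU.
have ev : meval (fun j => (j == i)%:R) Xv = (iv == i)%:R by apply: mevalXU.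
rewrite /= (morX _ _ (meval _)) /= eu ev (morX _ _ (intr : int -> rat)).
by rewrite !rmorph_nat rmorph0.
Qed.

Lemma Pcf_degrees n :
  [/\ size_in iu (Pcf Xu Xv n) = (maxn (2 * n) 1).+1,
      size_in iv (Pcf Xu Xv n) = (maxn (2 * n) 1).+1 &
      size_tot (Pcf Xu Xv n) = (maxn (2 * n) 1).+1].
Proof.
have [] := homog_sizes (dhomog_Pcf n) (meval_Xuv (i := iu) (X := Pcf) _ _).
- by move=> K L f u v; apply: rmorph_Pcf.
- exact: Pcf10_neq0.
have [] := homog_sizes (dhomog_Pcf n) (meval_Xuv (i := iv) (X := Pcf) _ _).
- by move=> K L f u v; apply: rmorph_Pcf.
- exact: Pcf01_neq0.
by [].
Qed.

Lemma Qcf_degrees n :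
  [/\ size_in iu (Qcf Xu Xv n) = (maxn (2 * n - 1) 0).+1,
      size_in iv (Qcf Xu Xv n) = (maxn (2 * n - 1) 0).+1 &
      size_tot (Qcf Xu Xv n) = (maxn (2 * n - 1) 0).+1].
Proof.
have [] := homog_sizes (dhomog_Qcf n) (meval_Xuv (i := iu) (X := Qcf) _ _).
- by move=> K L f u v; apply: rmorph_Qcf.
(* Both unit vectors satisfy (F + G) G >= 0. *)
- by apply: Qcf_neq0 => // *; apply: c2_10_neq0.
have [] := homog_sizes (dhomog_Qcf n) (meval_Xuv (i := iv) (X := Qcf) _ _).
- by move=> K L f u v; apply: rmorph_Qcf.
- by apply: Qcf_neq0 => // *; apply: c2_01_neq0.
by [].
Qed.
End Homogeneity.

(** * Distance to the partial sums of zeta(3) *)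

Section Estimates.
Variable K : realFieldType.
Implicit Types (n k m : nat) (F G : K).

Lemma harm3_leS n : harm3 K n <= harm3 K n.+1.
Proof. by rewrite /harm3 big_nat_recr//= lerDl invr_ge0 exprn_ge0. Qed.

Lemma harm3_le2 n : harm3 K n <= 2.
Proof.
(* The sharper bound 2 - 1 / (m + 1) is what the induction can carry. *)
suff H m : harm3 K m.+1 <= 2 - m.+1%:R^-1.
  by apply: le_trans (harm3_leS n) (le_trans (H n) _); rewrite gerBl invr_ge0.
elim: m => [|m IHm]; first by rewrite /harm3 big_nat1; lra.
rewrite /harm3 big_nat_recr//=; apply: le_trans (lerD IHm (lexx _)) _.
rewrite -[m.+2]addn1 natrD; move: m.+1%:R (ltr0Sn K m) => a a0.
rewrite -subr_ge0 (_ : _ - _ = (a ^+ 2 + a + 1) / (a * (a + 1) ^+ 3)).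
  by rewrite divr_ge0 ?addr_ge0 ?mulr_ge0 ?exprn_ge0 ?addr_ge0 ?ltW.
by field; rewrite !gt_eqF// addr_gt0.
Qed.

(** By symmetry C(n + k, k) = C(n + k, n) >= C(n + 1, n) = n + 1, as k >= 1. *)
Lemma binprod_ge n k : (0 < k <= n)%N -> n.+1%:R <= binprod K n k.
Proof.
case/andP=> k0 le_kn; rewrite /binprod ler_nat -[n.+1]mul1n leq_mul// ?bin_gt0//.
rewrite -{2}[k](addKn n) bin_sub ?leq_addr//.
rewrite -{1}(binSn n) leq_bin2l//.
by rewrite -addn1 leq_add2l.
Qed.

(** The lower bound on [binprod] extracts 1 / (2 (n + 1)) from every correction term; the cubes left
    over sum to at most 2. *)
Lemma apery_c_dist n k : (k <= n)%N -> `|apery_c K n k - harm3 K n| <= n.+1%:R^-1.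
Proof.
move=> le_kn; rewrite /apery_c addrC addKr; apply: le_trans (ler_norm_sum _ _ _) _.
have n0 := ltr0Sn K n.
apply: (@le_trans _ _ (\sum_(0 <= m < k) m.+1%:R ^- 3 * (2 * n.+1%:R)^-1)).
  rewrite big_nat [leRHS]big_nat; apply: ler_sum => m /= lt_mk.
  rewrite normrM normrX normrN1 expr1n mul1r normfV gtr0_norm; last first.
    rewrite !mulr_gt0// ?exprn_gt0// (lt_le_trans ltr01)//.
    by rewrite binprod_ge1// (leq_trans lt_mk).
  rewrite -invfM lef_pV2 ?posrE ?mulr_gt0 ?exprn_gt0//; last first.
    by rewrite (lt_le_trans ltr01)// binprod_ge1// (leq_trans lt_mk).
  rewrite mulrA (mulrC _ 2) ler_pM2l ?mulr_gt0 ?exprn_gt0//.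
  by rewrite binprod_ge// (leq_trans lt_mk).
rewrite -mulr_suml invfM mulrA ler_piMl ?invr_ge0//.
by rewrite ler_pdivrMr// mul1r harm3_le2.
Qed.

(** B / A is a mean of the [apery_c n k] with weights [binprod n k ^+ 2]. *)
Lemma aperyB_dist n : `|aperyB K n / aperyA K n - harm3 K n| <= n.+1%:R^-1.
Proof.
have A0 := aperyA_gt0 K n.
rewrite -(ler_pM2r A0) -[X in `|_| * X](gtr0_norm A0) -normrM mulrBl divfK ?gt_eqF//.
rewrite /aperyA /aperyB !mulr_sumr -sumrB.
apply: le_trans (ler_norm_sum _ _ _) _.
rewrite big_nat [leRHS]big_nat; apply: ler_sum => k /= lt_kn.
rewrite (mulrC (harm3 _ _)) -mulrBr normrM ger0_norm ?sqr_ge0// mulrC.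
by rewrite ler_wpM2r ?sqr_ge0 ?apery_c_dist.
Qed.

Lemma apery_mix_dist F G n : F + G != 0 -> 0 <= (F + G) * G ->
  `|apery_mix F G (aperyB K) n / apery_mix F G (aperyA K) n - harm3 K n.+1| <=
  (2 * (2 * `|G| + 3 * `|F|) / `|F + G| + 1) / n.+1%:R.
Proof.
move=> hFG hG; have hY := apery_mixA_gt0 n hG; have hZ := apery_mixAB F G n.
set Y := apery_mix F G (aperyA K) n in hY hZ *.
set Z := apery_mix F G (aperyB K) n in hZ *.
have A0 := aperyA_gt0 K n.+1; have A1 := aperyA_ge1 K n.+1.
have m0 := ltr0Sn K n; have m1 : 1 <= n.+1%:R :> K by rewrite ler1n.
have hB : `|aperyB K n.+1 / aperyA K n.+1 - harm3 K n.+1| <= n.+1%:R^-1.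
  by apply: le_trans (aperyB_dist _) _; rewrite lef_pV2 ?posrE// ler_nat.
set A := aperyA K n.+1 in A0 A1 hB hZ; set B := aperyB K n.+1 in hB hZ.
set m : K := n.+1%:R in hB hY hZ m0 m1 *; clearbody Y Z A B m.
have nFG : 0 < `|F + G| by rewrite normr_gt0.
have Yge : 3 * m * `|F + G| <= `|Y|.
  rewrite -(ler_pM2l nFG) -normrM; apply: le_trans (ler_norm _).
  by apply: le_trans hY; rewrite mulrCA -expr2 real_normK ?num_real.
have Y0 : 0 < `|Y| by apply: lt_le_trans Yge; rewrite !mulr_gt0.
have Yn0 : Y != 0 by rewrite -normr_gt0.
rewrite mulrDl mul1r -[Z / Y](subrK (B / A)) -addrA.
apply: le_trans (ler_normD _ _) (lerD _ hB).
(* The exact difference, from the Casoratian; it is small because |Y| >= 3 m |F + G| and A >= 1. *)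
have -> : Z / Y - B / A = - 6 * (2 * m ^+ 2 * G - 3 * m * F) / (m ^+ 3 * Y * A).
  by rewrite -hZ; field; rewrite Yn0 !gt_eqF.
have m30 : 0 < m ^+ 3 by rewrite exprn_gt0.
have normE : `|m ^+ 3 * Y * A| = m ^+ 3 * `|Y| * A.
  by rewrite 2!normrM (gtr0_norm m30) (gtr0_norm A0).
rewrite normrM normfV normE ler_pdivrMr ?mulr_gt0//.
rewrite normrM normrN [`|6|]ger0_norm//.
have q_le : `|2 * m ^+ 2 * G - 3 * m * F| <= m ^+ 2 * (2 * `|G| + 3 * `|F|).
  apply: le_trans (ler_normB _ _) _.
  have m2 : 0 <= 2 * m ^+ 2 by rewrite mulr_ge0 ?sqr_ge0.
  have m3 : 0 <= 3 * m by rewrite mulr_ge0 ?ltW.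
  rewrite (normrM (2 * _)) (normrM (3 * _)) (ger0_norm m2) (ger0_norm m3).
  rewrite [leRHS](_ : _ = 2 * m ^+ 2 * `|G| + 3 * m ^+ 2 * `|F|); last by ring.
  rewrite lerD2l ler_wpM2r// ler_wpM2l//.
  by rewrite expr2 ler_peMl// ltW.
set S := 2 * `|G| + 3 * `|F| in q_le *.
have S0 : 0 <= S by rewrite addr_ge0 ?mulr_ge0.
apply: (@le_trans _ _ (6 * (m ^+ 2 * S))); first by rewrite ler_pM2l.
(* The bound obtained is of order 1 / m^2; one power of m is given away. *)
apply: (@le_trans _ _ (2 * S / `|F + G| / m * (m ^+ 3 * (3 * m * `|F + G|) * 1))).
  rewrite [leRHS](_ : _ = 6 * (m ^+ 2 * S) * m); last first.
    by field; rewrite !gt_eqF.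
  by rewrite ler_peMr// mulr_ge0// mulr_ge0// exprn_ge0// ltW.
have c0 : 0 <= 2 * S / `|F + G| / m by rewrite !divr_ge0 ?mulr_ge0// ltW.
have d0 : 0 <= 3 * m * `|F + G| by rewrite !mulr_ge0// ltW.
apply: ler_wpM2l => //; apply: ler_pM => //.
  by rewrite mulr_ge0// ltW.
by rewrite ler_wpM2l// ltW.
Qed.

End Estimates.

From mathcomp Require Import boolp classical_sets reals topology normedtype
  sequences.
Import numFieldNormedType.Exports.
Local Open Scope classical_set_scope.
Local Open Scope ring_scope.

(** * Passage to the limit over the reals *)

Section Limit.
Variable R : realType.

Lemma harm3_cvg : harm3 R n @[n --> \oo] --> zeta3 R.
Proof.
(* [zeta3] is the [limn] of these same partial sums, so convergence alone is to be shown. *)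
apply: nondecreasing_is_cvgn.
  by apply/nondecreasing_seqP => n; apply: harm3_leS.
by exists 2 => _ [n _ <-]; apply: harm3_le2.
Qed.

(** Completing the square produces the discriminant [Delta x]; the sign of a g - (5 x + 3) selects
    k. *)
Lemma rho_root (x g : R) : 0 < x ->
    x * (3 * x + 2) * g ^+ 2 = 2 * (5 * x + 3) * g + 6 * (2 * x + 1) ->
  exists2 k, (1 <= k <= 2)%N & g = rho k x.
Proof.
move=> x0 eq_g; set a := x * (3 * x + 2).
have a0 : a != 0 by rewrite gt_eqF// mulr_gt0// addr_gt0 ?mulr_gt0.
have sq : (a * g - (5 * x + 3)) ^+ 2 = Delta x.
  rewrite [LHS](_ : _ = a * (a * g ^+ 2) - 2 * (5 * x + 3) * (a * g)
    + (5 * x + 3) ^+ 2); last by ring.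
  by rewrite eq_g /a /Delta; ring.
have gE : g = (5 * x + 3 + (a * g - (5 * x + 3))) / a.
  by rewrite addrC subrK mulrC mulKf.
have [h|h] := lerP 0 (a * g - (5 * x + 3)).
  by exists 2%N => //; rewrite /rho -/a -sq sqrtr_sqr ger0_norm// sqrrN expr1n mul1r.
by exists 1%N => //; rewrite /rho -/a -sq sqrtr_sqr ltr0_norm// expr1 mulN1r opprK.
Qed.

(** With x = 2 j (j + 1) and g = G / F, the quadratic factor of c_2(j) becomes a quadratic in g with
    roots rho_1(x) and rho_2(x). *)
Lemma c2_neq0 (F G : R) : F + G != 0 ->
    (F != 0 -> ~ @frakA R (G / F)) ->
  forall j, (0 < j)%N -> c2 F G j != 0.
Proof.
move=> hFG hA j j0; have [F0|F0] := eqVneq F 0.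
  rewrite (_ : c2 F G j = c2 0 1 j * G ^+ 2); last by rewrite F0 /c2 /=; ring.
  by rewrite mulf_neq0 ?c2_01_neq0// expf_neq0//; move: hFG; rewrite F0 add0r.
apply/eqP => c20; apply: (hA F0).
set x : R := (2 * j * j.+1)%:R.
have x0 : 0 < x by rewrite ltr0n !muln_gt0 j0.
have xE : x = 2 * j%:R * (j%:R + 1) by rewrite /x !natrM -[j.+1]addn1 natrD.
suff [k k12 gE] : exists2 k, (1 <= k <= 2)%N & G / F = rho k x by exists j, k.
apply: rho_root => //; apply/eqP; rewrite -subr_eq0; apply/eqP.
(* The outer factor of c_2(j) times F^2; d times the quadratic in g is 2 c_2(j). *)
pose d : R := - (j%:R + 1) * (j%:R + 2) ^+ 2 * (2 * j%:R + 1) * F ^+ 2.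
have pos k : (j%:R + k.+1%:R : R) != 0 by rewrite -natrD pnatr_eq0 addnS.
have odd_neq0 : 2 * j%:R + 1 != 0 :> R.
  by rewrite -natrM -(natrD _ _ 1) pnatr_eq0 addn1.
have d0 : d != 0.
  by rewrite !(mulf_neq0, oppr_eq0, expf_neq0) ?(pos 0%N) ?(pos 1%N).
apply: (mulfI d0); rewrite mulr0.
rewrite -[RHS](mul0r 2) -c20 /c2 /= -[j.+1]addn1 natrD xE /d.
by move: (j%:R) => t; field.
Qed.

Lemma PQ_cvg (F G : R) : F + G != 0 -> 0 <= (F + G) * G ->
    (forall j, (0 < j)%N -> c2 F G j != 0) ->
  Pcf F G n / Qcf F G n @[n --> \oo] --> 8 * (F + G) * zeta3 R.
Proof.
move=> hFG hG hc; rewrite -cvg_shiftS /=.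
pose r n := apery_mix F G (aperyB R) n.+1 / apery_mix F G (aperyA R) n.+1.
have -> : (fun n => Pcf F G n.+1 / Qcf F G n.+1) = (fun n => 8 * (F + G) * r n).
  apply/funext => n; rewrite PcfS QcfS /r.
  have := Qcf_neq0 n.+1 hFG hG hc; rewrite QcfS !mulf_eq0 !negb_or.
  move=> /andP[/andP[_ d0] Y0].
  by field; rewrite d0 Y0.
apply: cvgM; first exact: cvg_cst.
rewrite -[zeta3 R]addr0.
(* The partial sums tend to zeta(3), and the remainder is squeezed between multiples of the harmonic
   sequence. *)
have -> : r = (fun n => harm3 R n.+2) \+ (fun n => r n - harm3 R n.+2).
  by apply/funext => n /=; rewrite addrC subrK.
apply: cvgD.
  by rewrite (cvg_shiftS (fun n => harm3 R n.+1)) cvg_shiftS; apply: harm3_cvg.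
set C := 2 * (2 * `|G| + 3 * `|F|) / `|F + G| + 1.
apply: (@squeeze_cvgr _ _ _ _ (fun n => - (C * harmonic n.+1))
  (fun n => C * harmonic n.+1)).
- by near=> n; rewrite -ler_norml; apply: apery_mix_dist.
- rewrite -oppr0; apply: cvgN; rewrite -(mulr0 C); apply: cvgM; first exact: cvg_cst.
  by rewrite (cvg_shiftS (@harmonic R)); apply: cvg_harmonic.
- rewrite -(mulr0 C); apply: cvgM; first exact: cvg_cst.
  by rewrite (cvg_shiftS (@harmonic R)); apply: cvg_harmonic.
Unshelve. all: by end_near.
Qed.
End Limit.

Theorem theoremB (R : realType) (F G : R)
    (hFG : F + G != 0) (hG : 0 <= (F + G) * G)
    (hexc : F != 0 -> ~ (@frakB R `|` @frakA R) (G / F)) :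
  ((forall nu : nat, Qcf F G nu != 0) /\
   (Pcf F G nu / Qcf F G nu @[nu --> \oo] --> 8 * (F + G) * zeta3 R)) /\
  (forall nu : nat,
     [/\ homogeneous (Pcf Xu Xv nu),
         homogeneous (Qcf Xu Xv nu),
         [/\ size_in iu (Pcf Xu Xv nu) = (maxn (2 * nu) 1).+1,
             size_in iv (Pcf Xu Xv nu) = (maxn (2 * nu) 1).+1 &
             size_tot (Pcf Xu Xv nu) = (maxn (2 * nu) 1).+1] &
         [/\ size_in iu (Qcf Xu Xv nu) = (maxn (2 * nu - 1) 0).+1,
             size_in iv (Qcf Xu Xv nu) = (maxn (2 * nu - 1) 0).+1 &
             size_tot (Qcf Xu Xv nu) = (maxn (2 * nu - 1) 0).+1]]).
Proof.
have hc : forall j, (0 < j)%N -> c2 F G j != 0.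
  by apply: c2_neq0 => // F0 hA; apply: (hexc F0); right.
split; first by split=> [nu|]; [apply: Qcf_neq0|apply: PQ_cvg].
move=> nu; split.
- by exists (maxn (2 * nu) 1); apply: Homogeneity.dhomog_Pcf.
- by exists (maxn (2 * nu - 1) 0); apply: Homogeneity.dhomog_Qcf.
- exact: Homogeneity.Pcf_degrees.
- exact: Homogeneity.Qcf_degrees.
Qed.
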